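(* Let $0<q<1$ and let $\mu$ be a finite positive Borel measure on $[0,1)$. Then $\mathcal{H}_\mu$ is compact from $H^\infty$ to $B_q$.
   Context: Let $\mathbb{D}=\{z\in\mathbb{C}:|z|<1\}$ and let $H(\mathbb{D})$ be the space of all analytic functions on $\mathbb{D}$. $H^\infty$ is the space of $f\in H(\mathbb{D})$ with $\|f\|_\infty=\sup_{z\in\mathbb{D}}|f(z)|<\infty$. For $0\le r<1$ and $g\in H(\mathbb{D})$, $M_1(r,g)=\frac{1}{2\pi}\int_0^{2\pi}|g(re^{i\theta})|\,d\theta$. For $0<q<1$, $B_q$ is the space of all $g\in H(\mathbb{D})$ with $$\|g\|_{B_q}=\int_0^1(1-r)^{\frac{1}{q}-2}M_1(r,g)\,dr<\infty.$$ For a finite positive Borel measure $\mu$ on $[0,1)$ and an integer $n\ge 0$, put $\mu_n=\int_{[0,1)}t^n\,d\mu(t)$. For $f(z)=\sum_{n=0}^\infty a_nz^n\in H(\mathbb{D})$, the generalized Hilbert operator is $$\mathcal{H}_\mu(f)(z)=\sum_{n=0}^\infty\left(\sum_{k=0}^\infty\mu_{n+k}a_k\right)z^n,\quad z\in\mathbb{D},$$ whenever the right-hand side makes sense and defines an analytic function in $\mathbb{D}$.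
   Formalization: For some finite μ the series defining H_μ(f) diverge for certain f in H^∞, so H_μ is not defined on all of H^∞; compactness is stated on the set of f in H^∞ whose coefficient series all converge, where H_μ(f) is shown to be analytic. *)

(* Defs.v *)
From mathcomp Require Import all_boot all_order all_algebra.
From mathcomp Require Import all_classical all_reals all_analysis.
From mathcomp Require Import complex.

Set Implicit Arguments.
Unset Strict Implicit.
Unset Printing Implicit Defensive.

Import Order.TTheory GRing.Theory Num.Theory.
Import numFieldNormedType.Exports.

Local Open Scope classical_set_scope.
Local Open Scope ring_scope.

(* The field R[i], named as a numClosedFieldType: this is what makes the generic
   norm topology of mathcomp-analysis available on it.  The norm `|z| of Cplx R
   is valued in Cplx R; the real-valued modulus is Normc.normc. *)
Definition Cplx (R : realType) : numClosedFieldType := R[i].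

(* e^{it} *)
Definition cis (R : realType) (t : R) : Cplx R := (cos t +i* sin t)%C.

Definition unit_disc (R : realType) : set (Cplx R) :=
  [set z | Normc.normc z < 1].

(* f \in H(D).  Functions are total on C, but every notion in this file depends
   only on the values of its arguments in the unit disc. *)
Definition analytic_disc (R : realType) (f : Cplx R -> Cplx R) : Prop :=
  forall z : Cplx R, unit_disc z -> derivable f z 1.

Definition Hinf_norm (R : realType) (f : Cplx R -> Cplx R) : \bar R :=
  ereal_sup [set (Normc.normc (f z))%:E | z in @unit_disc R].

Definition Hinf (R : realType) (f : Cplx R -> Cplx R) : Prop :=
  analytic_disc f /\ (Hinf_norm f < +oo)%E.

Definition M1 (R : realType) (r : R) (g : Cplx R -> Cplx R) : \bar R :=
  (((2 * pi)^-1)%:E *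
   \int[lebesgue_measure]_(t in `[0%R, (2 * pi)%R])
      (Normc.normc (g (r%:C%C * cis t)))%:E)%E.

Definition Bq_norm (R : realType) (q : R) (g : Cplx R -> Cplx R) : \bar R :=
  (\int[lebesgue_measure]_(r in `[0%R, 1%R[)
      (((1 - r) `^ (q^-1 - 2))%:E * M1 r g))%E.

Definition Bq (R : realType) (q : R) (g : Cplx R -> Cplx R) : Prop :=
  analytic_disc g /\ (Bq_norm q g < +oo)%E.

Definition moment (R : realType)
    (mu : {finite_measure set (measurableTypeR R) -> \bar R}) (n : nat) : R :=
  \int[mu]_(t in `[0, 1[) (t ^+ n).

(* f(z) = sum_n a_n z^n for all z in the unit disc *)
Definition power_series_of (R : realType) (f : Cplx R -> Cplx R)
    (a : nat -> Cplx R) : Prop :=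
  forall z : Cplx R, unit_disc z ->
    series (fun n => a n * z ^+ n) @ \oo --> f z.

(* b_n = sum_k mu_{n+k} a_k, all these series being convergent *)
Definition hilbert_coefs (R : realType)
    (mu : {finite_measure set (measurableTypeR R) -> \bar R})
    (a b : nat -> Cplx R) : Prop :=
  forall n : nat,
    series (fun k => (moment mu (n + k))%:C%C * a k) @ \oo --> b n.

(* The graph of H_mu: H_mu(f) makes sense, is analytic in the disc, and equals
   g there.  For a general finite mu the series defining the coefficients may
   diverge for some f in Hinf, so H_mu is a partial operator on Hinf. *)
Definition hilbert_op (R : realType)
    (mu : {finite_measure set (measurableTypeR R) -> \bar R})
    (f g : Cplx R -> Cplx R) : Prop :=
  analytic_disc g /\
  exists a b : nat -> Cplx R,
    [/\ power_series_of f a, hilbert_coefs mu a b & power_series_of g b].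

(* Compactness from Hinf to B_q of the (possibly partial) operator of graph T:
   T maps its domain in Hinf into B_q, and the images of every norm-bounded
   sequence of its domain have a subsequence converging in B_q. *)
Definition compact_Hinf_Bq (R : realType) (q : R)
    (T : (Cplx R -> Cplx R) -> (Cplx R -> Cplx R) -> Prop) : Prop :=
  (forall f g : Cplx R -> Cplx R, Hinf f -> T f g -> Bq q g) /\
  (forall (f g : nat -> Cplx R -> Cplx R) (M : R),
     (forall j, Hinf (f j)) ->
     (forall j, (Hinf_norm (f j) <= M%:E)%E) ->
     (forall j, T (f j) (g j)) ->
     exists (phi : nat -> nat) (h : Cplx R -> Cplx R),
       [/\ {homo phi : i j / (i < j)%N},
           Bq q h &
           Bq_norm q (fun z => g (phi j) z - h z) @[j --> \oo] --> 0%E]).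

(* Main.v *)
Require Import Defs.
From mathcomp Require Import all_boot all_order all_algebra.
From mathcomp Require Import all_classical all_reals all_analysis.
From mathcomp Require Import measurable_realfun complex.
From mathcomp Require Import ring lra.
Set Implicit Arguments.
Unset Strict Implicit.
Unset Printing Implicit Defensive.
Import Order.TTheory GRing.Theory Num.Theory.
Import numFieldNormedType.Exports.
Local Open Scope classical_set_scope.
Local Open Scope ring_scope.

(** Write [b n] for the coefficients of the image [g] of [f].  Formally
    [b n] is the integral of [t ^ n * f t] against [mu], so that [b] is the
    moment sequence of a complex measure whose total mass is at most the mass
    of [mu] times the supremum of [|f|].
    The proof uses only one consequence of this, the predicate [moment_like A b]:

      if a polynomial [\sum_n c n * t ^ n] has modulus at most [K] on [0, 1),
      then [\sum_n c n * b n] has modulus at most [A * K].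

    [hilbert_coefs_moment_like] derives it although the series that define [b]
    converge only conditionally: by Abel's theorem it is enough to bound the
    series damped by [s ^ k] with [s < 1], and those are limits of sums of
    moments of polynomials, uniformly close to [f (s * t)] times the test
    polynomial.

    Two test polynomials are needed.  The monomials show that [b] is bounded, so
    that its power series is analytic in the disc ([power_series_analytic]).
    The partial sums of [1 / (1 - t * z)] give [|g z| <= 2 * A / d] as soon as
    [d <= |1 - t * z|] for all [t] in [0, 1).  For [z = r * e ^ (i theta)] the
    number [d] can be taken to be the maximum of [1 - r] and of a multiple of
    the distance from [theta] to the ends of [[0, 2 * pi]].  A geometric mean of
    these two bounds is integrable in [theta] and gives
    [M1 r g <= L * A * (1 - r) ^ (- tau)] with [tau > 0] as small as desired
    ([M1_growth]).  As [1 / q - 2 > -1], the weight of [B_q] absorbs this growth,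
    and the part of the norm coming from radii in [(rho, 1)] is at most a
    constant times [A * (1 - rho) ^ tau], uniformly over all [g] ([Bq_norm_bound]).

    Compactness follows.  For [f j] bounded by [M] the coefficients of the
    [g j] are [moment_like] with one constant, in particular uniformly bounded, so
    along a subsequence they converge one by one ([bounded_coefs_subsequence]).
    The limit sequence is again [moment_like], hence defines an element [h] of
    [B_q].  Convergence of bounded coefficients makes [g j - h] tend to 0
    uniformly on every disc of radius [rho < 1], and the bound on the norm near
    the boundary is uniform in [j]; hence [g j - h] tends to 0 in [B_q]. *)

(** * Moduli, limits and Abel means of complex sequences *)

Section Modulus.
Context {R : realType}.
Local Notation C := (Cplx R).
Local Notation nc := (@Normc.normc R).
Implicit Types (z w : C) (x y : R).

Lemma unit_discE z : unit_disc z = (nc z < 1).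
Proof. by []. Qed.

Lemma normc_ge0 z : 0 <= nc z.
Proof. by case: z => a b; exact: sqrtr_ge0. Qed.

Lemma normcE z : `|z| = (nc z)%:C%C.
Proof. by case: z. Qed.

Lemma normc_triangle z w : nc (z + w) <= nc z + nc w.
Proof. exact: le_normcD. Qed.

Lemma normc_opp z : nc (- z) = nc z.
Proof. exact: normcN. Qed.

Lemma normc_sub z w : nc (z - w) = nc (w - z).
Proof. by rewrite -normc_opp opprB. Qed.

Lemma normc_mul z w : nc (z * w) = nc z * nc w.
Proof. exact: Normc.normcM. Qed.

Lemma normc_exp z n : nc (z ^+ n) = nc z ^+ n.
Proof.
elim: n => [|n IH]; first by rewrite !expr0; exact: Normc.normc1.
by rewrite !exprS normc_mul IH.
Qed.

Lemma normc_zero : nc 0 = 0.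
Proof. exact: Normc.normc0. Qed.

Lemma normc_sum (I : Type) (r : seq I) (P : pred I) (F : I -> C) :
  nc (\sum_(i <- r | P i) F i) <= \sum_(i <- r | P i) nc (F i).
Proof.
elim/big_ind2 : _ => [|z x w y zx wy|//]; first by rewrite normc_zero.
by rewrite (le_trans (normc_triangle _ _))// lerD.
Qed.

Lemma Re_sum (I : Type) (r : seq I) (P : pred I) (F : I -> C) :
  complex.Re (\sum_(i <- r | P i) F i) = \sum_(i <- r | P i) complex.Re (F i).
Proof. by apply: (big_morph (@complex.Re R)) => // -[a b] [c d]. Qed.

Lemma Im_sum (I : Type) (r : seq I) (P : pred I) (F : I -> C) :
  complex.Im (\sum_(i <- r | P i) F i) = \sum_(i <- r | P i) complex.Im (F i).
Proof. by apply: (big_morph (@complex.Im R)) => // -[a b] [c d]. Qed.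

Lemma normc_real x : nc (x%:C)%C = `|x|.
Proof. by rewrite /= expr0n addr0 sqrtr_sqr. Qed.

Lemma normc_Re z : `|complex.Re z| <= nc z.
Proof.
case: z => a b /=; rewrite -sqrtr_sqr ler_wsqrtr// lerDl; exact: sqr_ge0.
Qed.

Lemma normc_Im z : `|complex.Im z| <= nc z.
Proof.
case: z => a b /=; rewrite -sqrtr_sqr ler_wsqrtr// lerDr; exact: sqr_ge0.
Qed.

Lemma normc_ReIm z : nc z <= `|complex.Re z| + `|complex.Im z|.
Proof.
case: z => a b /=.
rewrite -[leRHS]ger0_norm ?addr_ge0// -sqrtr_sqr ler_wsqrtr//.
rewrite sqrrD !real_normK ?num_real// lerD2r lerDl.
by rewrite mulrn_wge0// mulr_ge0.
Qed.

(** Convergence in [Cplx R] is defined with radii in [Cplx R] itself; since a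
    positive complex number is real, real radii suffice. *)
Lemma cvg_normcP (u : nat -> C) (l : C) :
  u @ \oo --> l <->
  forall e, 0 < e -> \forall n \near \oo, nc (u n - l) < e.
Proof.
split=> [/cvgrPdist_lt ul e e0|ul].
  have e0' : 0 < (e%:C)%C :> C by rewrite ltcR.
  apply: filterS (ul _ e0') => n.
  by rewrite normcE ltcR normc_sub.
apply/cvgrPdist_lt => -[e i]; rewrite ltcE/= => /andP[/eqP -> e0].
apply: filterS (ul _ e0) => n.
by rewrite normcE normc_sub => H; rewrite ltcR.
Qed.

Lemma cvg_normc {u : nat -> C} {l : C} :
  u @ \oo --> l -> nc (u n) @[n --> \oo] --> nc l.
Proof.
move=> /cvg_normcP ul; apply/cvgrPdist_lt => e e0.
apply: filterS (ul _ e0) => n; apply: le_lt_trans.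
have h1 := normc_triangle (u n - l) l.
have h2 := normc_triangle (l - u n) (u n).
rewrite ler_norml; move: h1 h2; rewrite !subrK (normc_sub l) => h1 h2.
apply/andP; split; lra.
Qed.

Lemma cvg_normc_le (u : nat -> C) (l : C) (B : R) :
  u @ \oo --> l -> (\forall n \near \oo, nc (u n) <= B) -> nc l <= B.
Proof.
move=> /cvg_normc ul uB; have <- := cvg_lim _ ul => //.
by apply: limr_le => //; apply: cvgP ul.
Qed.

Lemma cvg_ReIm (u : nat -> C) (a b : R) :
  complex.Re (u n) @[n --> \oo] --> a -> complex.Im (u n) @[n --> \oo] --> b ->
  u @ \oo --> ((a +i* b)%C : C).
Proof.
move=> /cvgrPdist_lt ua /cvgrPdist_lt ub; apply/cvg_normcP => e e0.
have e20 : 0 < e / 2 by rewrite divr_gt0.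
near=> n; rewrite (le_lt_trans (normc_ReIm _))//.
have -> : complex.Re (u n - (a +i* b)%C) = - (a - complex.Re (u n)).
  by case: (u n) => x y /=; rewrite opprB.
have -> : complex.Im (u n - (a +i* b)%C) = - (b - complex.Im (u n)).
  by case: (u n) => x y /=; rewrite opprB.
rewrite !normrN [e]splitr ltrD//.
  by near: n; exact: ua.
by near: n; exact: ub.
Unshelve. all: by end_near. Qed.

Lemma geometric_tail (rho : R) (K L : nat) : 0 <= rho -> rho < 1 ->
  \sum_(K <= k < L) rho ^+ k <= rho ^+ K / (1 - rho).
Proof.
move=> r0 r1; have r1' : 0 < 1 - rho by rewrite subr_gt0.
have [LK|KL] := leqP L K.
  by rewrite big_geq// divr_ge0 ?exprn_ge0// ltW.
rewrite ler_pdivlMr//.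
suff -> : (\sum_(K <= k < L) rho ^+ k) * (1 - rho) = rho ^+ K - rho ^+ L.
  by rewrite lerBlDr lerDl exprn_ge0.
rewrite mulr_suml (@telescope_sumr_eq _ _ _ (fun k => - rho ^+ k)) ?(ltnW KL)//.
  by rewrite opprK addrC.
by move=> k _; rewrite exprS; ring.
Qed.

(** A consequence of Abel's limit theorem.  The Abel means are presented through their partial sums, the form in
    which [hilbert_coefs_moment_like] can estimate them.  The proof compares the
    sum [v] with one Abel mean, for [s] close to 1. *)
Lemma abel_bound (u : nat -> C) (v : C) (B : R) :
  series u @ \oo --> v ->
  (forall s, 0 <= s -> s < 1 -> forall e, 0 < e ->
     \forall K \near \oo, nc (\sum_(0 <= k < K) u k * (s%:C)%C ^+ k) <= B + e) ->
  nc v <= B.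
Proof.
move=> uv H; apply/ler_addgt0Pl => e e0.
have e4 : 0 < e / 4 by rewrite divr_gt0.
pose W k := series u k.+1 - v.
have /cvg_normcP uv' := uv.
have [k0 _ Wk0] := uv' _ e4.
pose D := \sum_(0 <= k < k0) nc (W k).
have D0 : 0 <= D by apply: sumr_ge0 => k _; exact: normc_ge0.
have D1 : 0 < D + 1 by rewrite ltr_wpDl.
(* [s] is so close to 1 that the finitely many early partial sums, which
   may be far from [v], weigh at most [e / 4]. *)
pose s := 1 - (Num.min (e / 4) 1) / (D + 1).
have m0 : 0 < Num.min (e / 4) 1 by rewrite lt_min e4 ltr01.
have s0 : 0 <= s.
  rewrite subr_ge0 ler_pdivrMr// mul1r.
  by rewrite (@le_trans _ _ 1) ?ge_min ?lexx ?orbT// lerDr.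
have s1 : s < 1 by rewrite ltrBlDr ltrDl divr_gt0.
have sD : (1 - s) * D <= e / 4.
  rewrite /s opprB addrC subrK -mulrA [X in _ * X](_ : _ = D / (D + 1)); last by ring.
  rewrite (@le_trans _ _ (Num.min (e / 4) 1))// ?ge_min ?lexx//.
  by rewrite ler_piMr// ?(ltW m0)// ler_pdivrMr// mul1r lerDl.
clearbody s.
(* Summation by parts: the Abel mean is an average of the partial sums
   with weights [(1 - s) * s ^+ k], up to a boundary term. *)
have sp (K : nat) : \sum_(0 <= k < K.+1) u k * (s%:C)%C ^+ k =
    v + (s%:C)%C ^+ K * W K + ((1 - s)%:C)%C * \sum_(0 <= k < K) W k * (s%:C)%C ^+ k.
  have -> : ((1 - s)%:C)%C = 1 - (s%:C)%C :> C by rewrite rmorphB rmorph1.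
  elim: K => [|K IH].
    rewrite big_nat1 big_geq// expr0 /W /series /= big_nat1; ring.
  rewrite big_nat_recr//= {}IH [X in _ = _ + _ * X]big_nat_recr//=.
  have -> : u K.+1 = W K.+1 - W K.
    by rewrite /W /series /= [X in _ = X - _ - _]big_nat_recr//=; ring.
  by rewrite exprS; ring.
have [K0 _ HK0] := H _ s0 s1 _ e4.
pose K := maxn K0 k0.
have HK := HK0 K.+1 (leqW (leq_maxl _ _)).
have WK : nc (W K) < e / 4.
  by apply: Wk0; rewrite /= leqW// leq_maxr.
have tl : nc (((1 - s)%:C)%C * \sum_(0 <= k < K) W k * (s%:C)%C ^+ k) <= e / 4 + e / 4.
  rewrite normc_mul normc_real gtr0_norm ?subr_gt0//.
  rewrite (@big_cat_nat _ _ _ k0) ?leq_maxr//=.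
  apply: (@le_trans _ _ ((1 - s) * (D + (e / 4) * (\sum_(k0 <= k < K) s ^+ k)))).
    rewrite ler_wpM2l ?subr_ge0 ?(ltW s1)//.
    apply: le_trans (normc_triangle _ _) _; apply: lerD.
      rewrite (le_trans (normc_sum _ _ _))// ler_sum// => k _.
      rewrite normc_mul normc_exp normc_real ger0_norm// ler_piMr ?normc_ge0//.
      by rewrite exprn_ile1// ltW.
    rewrite (le_trans (normc_sum _ _ _))// mulr_sumr !big_nat ler_sum// => k /andP[kk _].
    rewrite normc_mul normc_exp normc_real ger0_norm// ler_wpM2r ?exprn_ge0//.
    by apply/ltW/Wk0; rewrite /= leqW.
  rewrite mulrDr lerD// mulrCA ler_piMr ?(ltW e4)//.
  rewrite mulrC -ler_pdivlMr ?subr_gt0// (le_trans (geometric_tail _ _ _ _))//.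
  by rewrite ler_pM2r ?invr_gt0 ?subr_gt0// exprn_ile1// ltW.
have sW : nc ((s%:C)%C ^+ K * W K) <= e / 4.
  rewrite normc_mul normc_exp normc_real ger0_norm//.
  by rewrite (le_trans _ (ltW WK))// ler_piMl ?normc_ge0// exprn_ile1// ltW.
move: HK sW tl; rewrite sp.
set a1 := (_ * W K); set a2 := (_ * \sum_(_ <= _ < _) _) => HK sW tl.
have -> : v = (v + a1 + a2) + (- a1 - a2) by ring.
have := normc_triangle (v + a1 + a2) (- a1 - a2).
have := normc_triangle (- a1) (- a2).
rewrite !normc_opp; lra.
Qed.

End Modulus.

(** * Polynomials in the moments and the coefficients of the image *)

Section Moments.
Context {R : realType}.
Local Notation C := (Cplx R).
Local Notation nc := (@Normc.normc R).
Variable mu : {finite_measure set (measurableTypeR R) -> \bar R}.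

Definition mass : R := fine (mu [set` `[0, 1[]).

Lemma mass_ge0 : 0 <= mass.
Proof. exact: fine_ge0. Qed.

Lemma integrable_bounded01 (f : R -> R) (B : R) :
  measurable_fun setT f -> (forall t, 0 <= t -> t < 1 -> `|f t| <= B) ->
  mu.-integrable [set` `[0, 1[] (EFin \o f).
Proof.
move=> mf fB; apply: measurable_bounded_integrable => //.
- by rewrite ltey_eq; apply/orP; left; exact: fin_num_measure.
- exact: measurable_funS mf.
- exists B; split; first exact: num_real.
  move=> x Bx t /=; rewrite in_itv/= => /andP[t0 t1].
  by rewrite (le_trans (fB _ t0 t1))// ltW.
Qed.

Lemma integrable_scaled_power (p : R) (m : nat) :
  mu.-integrable [set` `[0, 1[] (EFin \o (fun t => p * t ^+ m)).
Proof.
apply: (@integrable_bounded01 _ `|p|).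
  exact: measurable_funM.
move=> t t0 t1; rewrite normrM ler_piMr// normrX ger0_norm//.
by rewrite exprn_ile1// ltW.
Qed.

Lemma real_moment_sum (I : Type) (r : seq I) (p : I -> R) (e : I -> nat) :
  \sum_(i <- r) p i * moment mu (e i) =
  \int[mu]_(t in `[0, 1[) (\sum_(i <- r) p i * t ^+ e i).
Proof.
have intS (s : seq I) :
    mu.-integrable [set` `[0, 1[] (EFin \o (fun t => \sum_(i <- s) p i * t ^+ e i)).
  elim: s => [|i s IH].
    rewrite (_ : _ \o _ = cst 0%E); first exact: integrable0.
    by apply/funext => t /=; rewrite big_nil.
  rewrite (_ : _ \o _ = (EFin \o (fun t => p i * t ^+ e i)) \+
      (EFin \o (fun t => \sum_(i <- s) p i * t ^+ e i))).
    by apply: integrableD => //; exact: integrable_scaled_power.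
  by apply/funext => t /=; rewrite big_cons EFinD.
elim: r => [|i r IH].
  rewrite big_nil; under eq_Rintegral do rewrite big_nil.
  by rewrite /Rintegral integral0.
rewrite big_cons IH; under [RHS]eq_Rintegral do rewrite big_cons.
rewrite RintegralD//; last exact: integrable_scaled_power.
rewrite RintegralZl//.
apply: eq_integrable (integrable_scaled_power 1 (e i)) => // t _.
by rewrite /= mul1r.
Qed.

Lemma real_moment_sum_le (I : Type) (r : seq I) (p : I -> R) (e : I -> nat)
    (K : R) :
  (forall t, 0 <= t -> t < 1 -> `|\sum_(i <- r) p i * t ^+ e i| <= K) ->
  `|\sum_(i <- r) p i * moment mu (e i)| <= K * mass.
Proof.
move=> HK; rewrite real_moment_sum.
have mS : measurable_fun [set: R] (fun t : R => \sum_(i <- r) p i * t ^+ e i).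
  by apply: measurable_sum => i; exact: measurable_funM.
apply: le_trans (le_normr_Rintegral _ _) _ => //.
  exact: integrable_bounded01 mS HK.
have -> : K * mass = \int[mu]_(t in `[0, 1[) (cst K t).
  by rewrite Rintegral_cst.
apply: le_Rintegral => //.
- apply: (@integrable_bounded01 _ K); first exact: measurableT_comp mS.
  by move=> t t0 t1; rewrite normr_id HK.
- by apply: (@integrable_bounded01 _ `|K|).
- by move=> t /=; rewrite in_itv/= => /andP[]; exact: HK.
Qed.

(** The factor 2 comes from treating real and imaginary parts separately,
    which avoids integrals of complex functions.  The exponents are an arbitrary
    family [e] so that a product of two polynomials can be fed in without
    collecting equal powers. *)
Lemma moment_sum_le (I : Type) (r : seq I) (p : I -> C) (e : I -> nat) (K : R) :
  (forall t, 0 <= t -> t < 1 ->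
    nc (\sum_(i <- r) p i * (t%:C)%C ^+ e i) <= K) ->
  nc (\sum_(i <- r) p i * ((moment mu (e i))%:C)%C) <= 2 * K * mass.
Proof.
have ReM (z : C) (x : R) : complex.Re (z * (x%:C)%C) = complex.Re z * x.
  by case: z => a b /=; rewrite mulr0 subr0.
have ImM (z : C) (x : R) : complex.Im (z * (x%:C)%C) = complex.Im z * x.
  by case: z => a b /=; rewrite mulr0 add0r.
move=> HK; apply: le_trans (normc_ReIm _) _.
rewrite Re_sum Im_sum mulr2n mulrDl mul1r mulrDl; apply: lerD.
  under eq_bigr do rewrite ReM.
  apply: real_moment_sum_le => t t0 t1; apply: le_trans (HK _ t0 t1).
  apply: le_trans (normc_Re _); rewrite Re_sum le_eqVlt; apply/orP; left.
  by apply/eqP; congr `|_|; apply: eq_bigr => i _; rewrite -rmorphXn/= ReM.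
under eq_bigr do rewrite ImM.
apply: real_moment_sum_le => t t0 t1; apply: le_trans (HK _ t0 t1).
apply: le_trans (normc_Im _); rewrite Im_sum le_eqVlt; apply/orP; left.
by apply/eqP; congr `|_|; apply: eq_bigr => i _; rewrite -rmorphXn/= ImM.
Qed.

End Moments.

Section Dominated.
Context {R : realType}.
Local Notation C := (Cplx R).
Local Notation nc := (@Normc.normc R).

(** These are the sequences of values on monomials of the functionals on
    polynomials that have norm at most [A] for the supremum norm on [0, 1).
    Unlike a representation by a measure, this condition visibly passes to
    termwise limits. *)
Definition moment_like (A : R) (b : nat -> C) : Prop :=
  forall (N : nat) (c : nat -> C) (K : R),
    (forall t, 0 <= t -> t < 1 ->
      nc (\sum_(0 <= n < N) c n * (t%:C)%C ^+ n) <= K) ->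
    nc (\sum_(0 <= n < N) c n * b n) <= A * K.

(** The partial sums converge uniformly on [[0, s]] for [s < 1]: convergence at
    a larger radius [s'] bounds [a k * s' ^ k], and the tail on [[0, s]] is then
    dominated by a geometric tail of ratio [s / s']. *)
Lemma power_series_uniform (f : C -> C) (a : nat -> C) (s e : R) :
  power_series_of f a -> 0 <= s -> s < 1 -> 0 < e ->
  \forall K \near \oo, forall t, 0 <= t -> t < 1 ->
    nc (f (((s * t)%:C)%C) - \sum_(0 <= k < K) a k * ((s * t)%:C)%C ^+ k) <= e.
Proof.
move=> fa s0 s1 e0.
pose s' := (s + 1) / 2.
have ss' : s < s' by rewrite /s'; lra.
have s'1 : s' < 1 by rewrite /s'; lra.
have s'0 : 0 < s' by rewrite /s'; lra.
have [A A0 aA] : exists2 A : R, 0 <= A & forall k, nc (a k) * s' ^+ k <= A.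
  have cv : cvgn (series (fun n => a n * (s'%:C)%C ^+ n)).
    by apply: cvgP; apply: fa; rewrite unit_discE normc_real gtr0_norm.
  have /cvg_normcP/(_ 1 ltr01)[K0 _ HK0] := cvg_series_cvg_0 cv.
  exists (1 + \sum_(k < K0) nc (a k) * s' ^+ k).
    rewrite addr_ge0// sumr_ge0// => k _.
    by rewrite mulr_ge0 ?normc_ge0// exprn_ge0// ltW.
  move=> k; have pos j : 0 <= nc (a j) * s' ^+ j.
    by rewrite mulr_ge0 ?normc_ge0// exprn_ge0// ltW.
  have [kK|Kk] := ltnP k K0.
    rewrite (bigD1 (Ordinal kK))//= addrCA lerDl.
    by rewrite addr_ge0// sumr_ge0.
  rewrite (le_trans (_ : _ <= 1))//; last by rewrite lerDl sumr_ge0.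
  have := HK0 k Kk; rewrite subr0 normc_mul normc_exp normc_real gtr0_norm//.
  exact: ltW.
pose rho := s / s'.
have r0 : 0 <= rho by rewrite divr_ge0// ltW.
have r1 : rho < 1 by rewrite ltr_pdivrMr// mul1r.
have tail0 : A * (rho ^+ K / (1 - rho)) @[K --> \oo] --> (0 : R).
  rewrite -[X in _ --> X](mulr0 A); apply: cvgMr.
  rewrite -[X in _ --> X](mul0r (1 - rho)^-1); apply: cvgMl.
  by apply: cvg_expr; rewrite ger0_norm.
have [K1 _ HK1] : \forall K \near \oo, A * (rho ^+ K / (1 - rho)) < e.
  have /cvgrPdist_lt/(_ _ e0) := tail0; apply: filterS => K.
  rewrite sub0r normrN => /(le_lt_trans (ler_norm _)); exact.
exists K1 => // K K1K t t0 t1.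
have st0 : 0 <= s * t by rewrite mulr_ge0.
have st1 : s * t < 1 by rewrite (le_lt_trans _ s1)// ler_piMr// ltW.
have sts : s * t <= s by rewrite ler_piMr// ltW.
apply: (@cvg_normc_le _ (fun L => series (fun k => a k * ((s * t)%:C)%C ^+ k) L
   - \sum_(0 <= k < K) a k * ((s * t)%:C)%C ^+ k)).
  apply: cvgB; last exact: cvg_cst.
  by apply: fa; rewrite unit_discE normc_real ger0_norm.
exists K => // L /= KL.
rewrite /series/= (big_cat_nat (n := K))//= addrAC subrr add0r.
apply: le_trans (normc_sum _ _ _) _.
rewrite (le_trans _ (ltW (HK1 _ K1K)))//.
rewrite (le_trans _ (ler_wpM2l A0 (geometric_tail K L r0 r1)))//.
rewrite mulr_sumr ler_sum// => k _.
rewrite normc_mul normc_exp normc_real ger0_norm//.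
rewrite (@le_trans _ _ (nc (a k) * s ^+ k))//.
  by rewrite ler_wpM2l ?normc_ge0// lerXn2r// ?nnegrE.
have -> : s ^+ k = s' ^+ k * rho ^+ k.
  by rewrite -exprMn /rho mulrCA divff ?mulr1// gt_eqF.
by rewrite mulrA ler_wpM2r// exprn_ge0.
Qed.

(** Exchanging the finite sum over [n] with the series over [k] writes
    [\sum_n c n * b n] as one convergent series.  Its Abel means are limits of
    moment sums of the polynomials [P t * S (s * t)], where [P] is the test
    polynomial and [S] a partial sum of [f], and [S (s * t)] is uniformly within
    [e'] of [f (s * t)], whose modulus is at most [M]. *)
Lemma hilbert_coefs_moment_like
    (mu : {finite_measure set (measurableTypeR R) -> \bar R})
    (f : C -> C) (a b : nat -> C) (M : R) :
  (forall z, unit_disc z -> nc (f z) <= M) ->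
  power_series_of f a -> hilbert_coefs mu a b ->
  moment_like (2 * M * mass mu) b.
Proof.
move=> fM fa hb N c K HK.
have M0 : 0 <= M.
  by apply: le_trans (fM 0 _); rewrite ?normc_ge0// unit_discE normc_zero.
have K0 : 0 <= K by apply: le_trans (HK 0 _ _); rewrite ?normc_ge0.
pose u k := a k * \sum_(0 <= n < N) c n * ((moment mu (n + k))%:C)%C.
have uv : series u @ \oo --> \sum_(0 <= n < N) c n * b n.
  have -> : series u = fun L => \sum_(0 <= n < N)
      c n * series (fun k => ((moment mu (n + k))%:C)%C * a k) L.
    apply/funext => L; rewrite /series/= /u.
    under eq_bigr do rewrite mulr_sumr.
    rewrite exchange_big; apply: eq_bigr => n _.
    by rewrite mulr_sumr; apply: eq_bigr => k _; rewrite mulrCA [a k * _]mulrC.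
  apply: cvg_big => [|n _]; first exact: add_continuous.
  by apply: cvgMr; exact: hb.
apply: (abel_bound uv) => s s0 s1 e e0.
pose m := mass mu.
have m0 : 0 <= m := mass_ge0 mu.
(* The error of the moment sums is [2 * K * m * e'], hence below [e]. *)
pose e' := e / (2 * K * m + 1).
have e'0 : 0 < e' by rewrite divr_gt0// ltr_wpDl// !mulr_ge0.
have := power_series_uniform fa s0 s1 e'0.
apply: filterS => L HL.
have -> : \sum_(0 <= k < L) u k * (s%:C)%C ^+ k =
   \sum_(i <- [seq (n, k) | n <- index_iota 0 N, k <- index_iota 0 L])
     (c i.1 * (a i.2 * (s%:C)%C ^+ i.2)) * ((moment mu (i.1 + i.2))%:C)%C.
  rewrite big_allpairs_dep/= /u exchange_big/=; apply: eq_bigr => k _.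
  rewrite mulrAC mulr_sumr; apply: eq_bigr => n _; ring.
apply: (le_trans (moment_sum_le mu (K := K * (M + e')) _)).
  move=> t t0 t1.
  have -> : \sum_(i <- [seq (n, k) | n <- index_iota 0 N, k <- index_iota 0 L])
     (c i.1 * (a i.2 * (s%:C)%C ^+ i.2)) * (t%:C)%C ^+ (i.1 + i.2) =
     (\sum_(0 <= n < N) c n * (t%:C)%C ^+ n) *
     (\sum_(0 <= k < L) a k * ((s * t)%:C)%C ^+ k).
    rewrite big_allpairs_dep/= mulr_suml; apply: eq_bigr => n _.
    rewrite mulr_sumr; apply: eq_bigr => k _.
    rewrite rmorphM exprMn exprD; ring.
  rewrite normc_mul ler_pM ?normc_ge0 ?HK//.
  have st : unit_disc ((s * t)%:C)%C.
    rewrite unit_discE normc_real ger0_norm ?mulr_ge0//.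
    by rewrite (le_lt_trans _ s1)// ler_piMr// ltW.
  have := fM _ st; have := HL _ t0 t1.
  set F := f _; set S := \sum_(_ <= _ < _) _.
  have := normc_triangle (S - F) F; rewrite subrK (normc_sub S); lra.
rewrite -/m (_ : 2 * (K * (M + e')) * m = 2 * M * m * K + 2 * K * m * e'); last by ring.
rewrite lerD2l /e' mulrCA ler_piMr ?(ltW e0)// ler_pdivrMr ?ltr_wpDl ?mulr_ge0//.
by rewrite mul1r lerDl.
Qed.

End Dominated.

(** * Power series with bounded coefficients *)

Section BoundedPowerSeries.
Context {R : realType}.
Local Notation C := (Cplx R).
Local Notation nc := (@Normc.normc R).

Lemma bounded_series_tail (b : nat -> C) (B : R) (z : C) (K L : nat) :
  (forall n, nc (b n) <= B) -> nc z < 1 ->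
  nc (\sum_(K <= k < L) b k * z ^+ k) <= B * (nc z ^+ K / (1 - nc z)).
Proof.
move=> bB z1; have B0 : 0 <= B := le_trans (normc_ge0 _) (bB 0%N).
apply: le_trans (normc_sum _ _ _) _.
rewrite (le_trans _ (ler_wpM2l B0 (geometric_tail K L (normc_ge0 z) z1)))//.
rewrite mulr_sumr ler_sum// => k _.
by rewrite normc_mul normc_exp ler_wpM2r// exprn_ge0// normc_ge0.
Qed.

Definition pser (b : nat -> C) (z : C) : C :=
  lim (series (fun n => b n * z ^+ n) @ \oo).

Lemma pserP (b : nat -> C) (B : R) (z : C) :
  (forall n, nc (b n) <= B) -> nc z < 1 ->
  series (fun n => b n * z ^+ n) @ \oo --> pser b z.
Proof.
move=> bB z1; apply/cvg_ex.
have geo : cvgn (series (geometric B (nc z))).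
  by apply: is_cvg_geometric_series; rewrite ger0_norm ?normc_ge0.
have le k : nc (b k * z ^+ k) <= geometric B (nc z) k.
  by rewrite /geometric/= normc_mul normc_exp ler_wpM2r// exprn_ge0// normc_ge0.
have cRe : cvgn (series (fun k => complex.Re (b k * z ^+ k))).
  apply: normed_cvg; apply: (series_le_cvg _ _ _ geo) => k //=.
    exact: le_trans (normc_ge0 _) (le k).
  exact: le_trans (normc_Re _) (le k).
have cIm : cvgn (series (fun k => complex.Im (b k * z ^+ k))).
  apply: normed_cvg; apply: (series_le_cvg _ _ _ geo) => k //=.
    exact: le_trans (normc_ge0 _) (le k).
  exact: le_trans (normc_Im _) (le k).
eexists; apply: cvg_ReIm.
- rewrite /series/=; under eq_fun do rewrite Re_sum; exact: cRe.
- rewrite /series/=; under eq_fun do rewrite Im_sum; exact: cIm.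
Qed.

Lemma power_series_pser (b : nat -> C) (B : R) :
  (forall n, nc (b n) <= B) -> power_series_of (pser b) b.
Proof. by move=> bB z z1; apply: pserP bB _. Qed.

Lemma power_seriesE (g : C -> C) (b : nat -> C) (z : C) :
  power_series_of g b -> nc z < 1 -> g z = pser b z.
Proof.
move=> gb z1; apply/esym/cvg_lim; first exact: norm_hausdorff.
exact: gb.
Qed.

Lemma normc_pser (b : nat -> C) (B : R) (z : C) :
  (forall n, nc (b n) <= B) -> nc z < 1 -> nc (pser b z) <= B / (1 - nc z).
Proof.
move=> bB z1; apply: (cvg_normc_le (pserP bB z1)).
apply: nearW => n; rewrite /series/=.
by have := bounded_series_tail 0 n bB z1; rewrite expr0 div1r.
Qed.

Lemma pser_shift (b : nat -> C) (B : R) (z : C) :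
  (forall n, nc (b n) <= B) -> nc z < 1 ->
  pser b z = b 0%N + z * pser (fun k => b k.+1) z.
Proof.
move=> bB z1; apply/cvg_lim; first exact: norm_hausdorff.
have bSB n : nc (b n.+1) <= B by [].
rewrite -(cvg_shiftS (series _)).
have -> : [sequence series (fun n => b n * z ^+ n) n.+1]_n =
  (fun n => b 0%N + z * series (fun k => b k.+1 * z ^+ k) n).
  apply/funext => n /=; rewrite /series/= big_nat_recl// expr0 mulr1.
  congr (_ + _); rewrite mulr_sumr; apply: eq_bigr => k _; rewrite exprS; ring.
apply: cvgD; first exact: cvg_cst.
by apply: cvgMr; exact: (pserP bSB).
Qed.

Lemma cvg_addB (u v : nat -> C) (x y k : C) :
  u @ \oo --> x -> v @ \oo --> y ->
  (fun n => u n + v n - k) @ \oo --> x + y - k.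
Proof. by move=> ux vy; apply: (cvgB (cvgD ux vy)); exact: cvg_cst. Qed.

(** The divided difference of a bounded power series is again one.  Its
    coefficients are the values at [z] of the shifted series, and the
    identity telescopes on partial sums.  Used once it gives a candidate for the
    derivative, used twice it gives the remainder estimate. *)
Lemma pser_divided_difference (b : nat -> C) (B : R) (z : C) :
  (forall n, nc (b n) <= B) -> nc z < 1 ->
  exists2 c : nat -> C, (forall n, nc (c n) <= B / (1 - nc z)) &
    forall w : C, nc w < 1 -> pser b w - pser b z = (w - z) * pser c w.
Proof.
move=> bB z1; pose p k := pser (fun j => b (k + j)%N) z.
have bkB k n : nc (b (k + n)%N) <= B by [].
have pB k : nc (p k) <= B / (1 - nc z) by apply: normc_pser.
exists (fun k => p k.+1) => // w w1.
have pS k : p k = b k + z * p k.+1.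
  rewrite /p (pser_shift (bkB k) z1) addn0; congr (_ + _ * pser _ _).
  by apply/funext => j; rewrite addnS.
have tel K : (w - z) * (\sum_(0 <= k < K) p k.+1 * w ^+ k) =
    \sum_(0 <= k < K) b k * w ^+ k + p K * w ^+ K - p 0%N.
  elim: K => [|K IH]; first by rewrite !big_geq// expr0; ring.
  by rewrite !big_nat_recr//= mulrDr IH (pS K) exprS; ring.
have pw0 : p K * w ^+ K @[K --> \oo] --> (0 : C).
  apply/cvg_normcP => e e0.
  have cv : (B / (1 - nc z)) * nc w ^+ K @[K --> \oo] --> (0 : R).
    rewrite -[X in _ --> X](mulr0 (B / (1 - nc z))); apply: cvgMr.
    by apply: cvg_expr; rewrite ger0_norm ?normc_ge0.
  have /cvgrPdist_lt/(_ _ e0) := cv; apply: filterS => K.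
  rewrite sub0r normrN subr0 => /(le_lt_trans (ler_norm _)); apply: le_lt_trans.
  by rewrite normc_mul normc_exp ler_wpM2r// exprn_ge0// normc_ge0.
have e1 : (w - z) * series (fun k => p k.+1 * w ^+ k) n @[n --> \oo] -->
   ((w - z) * pser (fun k => p k.+1) w : C).
  by apply: cvgMr; exact: pserP w1.
have e2 : (w - z) * series (fun k => p k.+1 * w ^+ k) n @[n --> \oo] -->
   (pser b w + 0 - p 0%N : C).
  have -> : (fun n => (w - z) * series (fun k => p k.+1 * w ^+ k) n) =
    (fun n => series (fun k => b k * w ^+ k) n + p n * w ^+ n - p 0%N).
    by apply/funext => n; exact: tel.
  exact: cvg_addB (pserP bB w1) pw0.
rewrite -[pser b w]addr0.
by apply: cvg_unique e2 e1; exact: norm_hausdorff.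
Qed.

(** The quotient at [z + h] is [pser c (z + h)], and its distance to
    [pser c z] is [|h|] times a bounded power series. *)
Lemma power_series_analytic (g : C -> C) (b : nat -> C) (B : R) :
  (forall n, nc (b n) <= B) -> power_series_of g b -> analytic_disc g.
Proof.
move=> bB gb z; rewrite unit_discE => z1.
have [c cB gc] := pser_divided_difference bB z1.
have [c' c'B qc] := pser_divided_difference cB z1.
set B' := _ / _ in c'B.
have B'0 : 0 <= B' := le_trans (normc_ge0 _) (c'B 0%N).
pose d := (1 - nc z) / 2.
have d0 : 0 < d by rewrite /d; lra.
rewrite /derivable; apply: (@cvgP _ _ (pser c z)).
apply/cvgrPdist_lt => -[e i]; rewrite ltcE/= => /andP[/eqP -> e0].
pose d' := Num.min d (e * d / (B' + 1)).
have d'0 : 0 < d'.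
  have ed : 0 < e * d by exact: mulr_gt0.
  have B'1 : 0 < B' + 1 by exact: ltr_wpDl.
  by rewrite lt_min d0 divr_gt0.
have d'C : 0 < (d'%:C)%C :> C by rewrite ltcR.
have near_small : \forall h \near (0 : C)^', nc h < d'.
  by apply: filterS (dnbhs0_lt d'C) => h; rewrite normcE ltcR.
near=> h.
have h0 : h != 0 by near: h; exact: (@withinT _ _ (fun h : C => h != 0)).

have hd' : nc h < d' by near: h; exact: near_small.
have hd : nc h < d by rewrite (lt_le_trans hd')// ge_min lexx.
have hz : nc (h + z) < 1 - d.
  have := normc_triangle h z; rewrite /d in hd *; lra.
have hz1 : nc (h + z) < 1 by lra.
rewrite /= /shift/= /GRing.scale/= mulr1.
rewrite !(power_seriesE gb)// gc// addrK mulKf//.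
rewrite normcE ltcR normc_sub qc// addrK normc_mul.
rewrite (@le_lt_trans _ _ (nc h * (B' / d)))//.
  rewrite ler_wpM2l ?normc_ge0//; apply: le_trans (normc_pser c'B hz1) _.
  by rewrite ler_wpM2l// lef_pV2 ?posrE ?subr_gt0//; lra.
rewrite (@le_lt_trans _ _ (nc h * ((B' + 1) / d)))//.
  by rewrite ler_wpM2l ?normc_ge0// ler_wpM2r ?invr_ge0 ?(ltW d0)// lerDl.
have Bd : 0 < (B' + 1) / d by rewrite divr_gt0// ltr_wpDl.
rewrite -(ltr_pdivlMr _ _ Bd) invf_div mulrA.
by rewrite (lt_le_trans hd')// ge_min lexx orbT.
Unshelve. all: by end_near. Qed.

End BoundedPowerSeries.

(** * Estimates through the kernel 1 / (1 - t z) *)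

Section Kernel.
Context {R : realType}.
Local Notation C := (Cplx R).
Local Notation nc := (@Normc.normc R).

Lemma moment_like_coef (A : R) (b : nat -> C) (n : nat) :
  moment_like A b -> nc (b n) <= A.
Proof.
move=> /(_ n.+1 (fun k => (k == n)%:R) 1); rewrite mulr1.
have pick (F : nat -> C) : \sum_(0 <= k < n.+1) (k == n)%:R * F k = F n.
  rewrite big_nat_recr//= eqxx mul1r big_nat big1 ?add0r// => k /= kn.
  by rewrite lt_eqF ?mul0r.
rewrite pick; apply=> t t0 t1.
by rewrite pick normc_exp normc_real ger0_norm// exprn_ile1// ltW.
Qed.

Lemma moment_like_lim (A : R) (b : nat -> nat -> C) (beta : nat -> C) :
  (forall j, moment_like A (b j)) ->
  (forall n, b j n @[j --> \oo] --> beta n) ->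
  moment_like A beta.
Proof.
move=> Ab bbeta N c K HK.
apply: (@cvg_normc_le _ (fun j => \sum_(0 <= n < N) c n * b j n)).
  apply: cvg_big => [|n _]; first exact: add_continuous.
  by apply: cvgMr; exact: bbeta.
by apply: nearW => j; exact: Ab.
Qed.

Lemma moment_likeB (A A' : R) (b b' : nat -> C) :
  moment_like A b -> moment_like A' b' ->
  moment_like (A + A') (fun n => b n - b' n).
Proof.
move=> Ab Ab' N c K HK.
have -> : \sum_(0 <= n < N) c n * (b n - b' n) =
  \sum_(0 <= n < N) c n * b n - \sum_(0 <= n < N) c n * b' n.
  by rewrite -sumrB; apply: eq_bigr => n _; rewrite mulrBr.
apply: le_trans (normc_triangle _ _) _.
by rewrite normc_opp mulrDl lerD// ?Ab ?Ab'.
Qed.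

(** The test polynomial is a partial sum of [1 / (1 - t * z)], equal to
    [(1 - (t * z) ^ N) / (1 - t * z)], hence of modulus at most [2 / d] on [0, 1)
    for every [N]. *)
Lemma moment_like_kernel (A : R) (b : nat -> C) (g : C -> C) (z : C) (d : R) :
  moment_like A b -> power_series_of g b -> nc z < 1 -> 0 < d ->
  (forall t, 0 <= t -> t < 1 -> d <= nc (1 - (t%:C)%C * z)) ->
  nc (g z) <= A * (2 / d).
Proof.
move=> Ab gb z1 d0 Hd.
apply: (cvg_normc_le (gb _ z1)); apply: nearW => N.
rewrite /series/=; under eq_bigr do rewrite mulrC.
apply: Ab => t t0 t1; have dt := Hd t t0 t1.
have dt0 : 0 < nc (1 - (t%:C)%C * z) by exact: lt_le_trans dt.
rewrite ler_pdivlMr// (le_trans (ler_wpM2l (normc_ge0 _) dt))// -normc_mul.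
have -> : (\sum_(0 <= n < N) z ^+ n * (t%:C)%C ^+ n) * (1 - (t%:C)%C * z) =
    1 - ((t%:C)%C * z) ^+ N.
  rewrite big_mkord -[in RHS](expr1n _ N) subrXX mulrC; congr (_ * _).
  by apply: eq_bigr => n _; rewrite expr1n mul1r exprMn mulrC.
apply: le_trans (normc_triangle _ _) _.
rewrite [X in X + _](_ : _ = 1); last exact: Normc.normc1.
rewrite normc_opp normc_exp normc_mul normc_real ger0_norm//.
rewrite -[2]/(1 + 1) lerD2l exprn_ile1 ?mulr_ge0 ?normc_ge0//.
by rewrite mulr_ile1 ?normc_ge0// ltW.
Qed.

(** Where the cosine is at least 1/2 this is the mean value theorem; elsewhere
    the sine is at least 1/2, while [x / 4 < 1 / 2] because [pi / 2 < 2]. *)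
Lemma sin_ge_quarter (x : R) : 0 <= x -> x <= pi / 2 -> x / 4 <= sin x.
Proof.
move=> x0 xpi; have pi2 := pihalf_lt2 R.
have s0 : 0 <= sin x by apply: sin_ge0_pi; rewrite x0/=; lra.
have [c2|c2] := lerP (1 / 2) (cos x).
  have cs : {within `[0, x], continuous sin}.
    by apply: continuous_subspaceT => y; exact: continuous_sin.
  have [c] := @MVT_segment R sin cos 0 x x0 (fun y _ => is_derive_sin y) cs.
  rewrite in_itv/= => /andP[c0 cx].
  rewrite sin0 !subr0 => ->.
  have cc : cos x <= cos c.
    move: cx; rewrite le_eqVlt => /orP[/eqP ->//|cx].
    by apply/ltW; rewrite ltr_cos// in_itv/= ?x0 ?c0; lra.
  nra.
have cc0 : 0 <= cos x by apply: cos_ge0_pihalf; lra.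
have := cos2Dsin2 x; nra.
Qed.

Lemma normc_one_sub_cis (rho theta : R) :
  nc (1 - (rho%:C)%C * cis theta) =
  Num.sqrt ((1 - rho * cos theta) ^+ 2 + (rho * sin theta) ^+ 2).
Proof.
rewrite /cis /= !mul0r subr0 addr0; congr Num.sqrt; ring.
Qed.

(** The modulus is at least [1 - t * r], hence at least [1 - r].  For the other
    bound, with [rho = t * r] and [s = sin (theta / 2)] the squared modulus is
    [(1 - rho) ^ 2 + 4 * rho * s ^ 2].  It is affine in [s ^ 2] and at least
    [s ^ 2] both for [s ^ 2 = 0] and for [s ^ 2 = 1]; it remains to bound [s]. *)
Lemma circle_gap (r theta t : R) : 0 <= r -> r < 1 ->
  0 <= theta -> theta <= 2 * pi -> 0 <= t -> t < 1 ->
  Num.max (1 - r) (Num.min theta (2 * pi - theta) / 8) <=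
  nc (1 - (t%:C)%C * ((r%:C)%C * cis theta)).
Proof.
move=> r0 r1 th0 th1 t0 t1.
rewrite mulrA -rmorphM normc_one_sub_cis; set rho := t * r.
have rho0 : 0 <= rho by rewrite mulr_ge0.
have rhor : rho <= r by rewrite ler_piMl// ltW.
pose s := sin (theta / 2).
have cE : cos theta = 1 - 2 * s ^+ 2.
  have {1}-> : theta = theta / 2 *+ 2 by rewrite mulr2n -splitr.
  by rewrite cos_mulr2n cos2sin2 -/s; ring.
have sge : Num.min theta (2 * pi - theta) / 8 <= s.
  have [h|h] := lerP (theta / 2) (pi / 2).
    have := @sin_ge_quarter (theta / 2); rewrite -/s.
    have : Num.min theta (2 * pi - theta) <= theta by rewrite ge_min lexx.
    lra.
  have -> : s = sin (pi - theta / 2).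
    by rewrite sinB sinpi cospi mul0r sub0r mulN1r opprK.
  have := @sin_ge_quarter (pi - theta / 2).
  have : Num.min theta (2 * pi - theta) <= 2 * pi - theta by rewrite ge_min lexx orbT.
  lra.
have s0 : 0 <= s by apply: sin_ge0_pi; lra.
have s1 : s <= 1 by exact: sin_le1.
have E : (1 - rho * cos theta) ^+ 2 + (rho * sin theta) ^+ 2 =
    (1 - rho) ^+ 2 + 4 * rho * s ^+ 2.
  rewrite exprMn sin2cos2 cE; ring.
rewrite E ge_max; apply/andP; split.
  rewrite -[leLHS]ger0_norm ?subr_ge0 ?(ltW r1)// -sqrtr_sqr ler_wsqrtr//.
  nra.
apply: le_trans sge _.
rewrite -[leLHS]ger0_norm// -sqrtr_sqr ler_wsqrtr//.
have ss : s ^+ 2 <= 1 by rewrite exprn_ile1.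
have ss0 : 0 <= s ^+ 2 by exact: sqr_ge0.
rewrite -subr_ge0 (_ : _ - _ =
  (1 - s ^+ 2) * (1 - rho) ^+ 2 + s ^+ 2 * (rho * (rho + 2))); last by ring.
by rewrite addr_ge0// mulr_ge0 ?sqr_ge0 ?subr_ge0// mulr_ge0// addr_ge0.
Qed.

Lemma normc_circle (r theta : R) : 0 <= r -> nc ((r%:C)%C * cis theta) = r.
Proof.
move=> r0; rewrite normc_mul normc_real ger0_norm//.
by rewrite /cis /= cos2Dsin2 sqrtr1 mulr1.
Qed.

End Kernel.

(** * An integrable majorant of a power singularity *)

Section IntegralMono.
Local Open Scope ereal_scope.

(** The integral of a nonnegative function is the supremum over the simple
    functions below it, so it is monotone whether or not the functions are
    measurable.  One of the functions compared later is [r |-> M1 r g]. *)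
Lemma ge0_integral_mono d (T : measurableType d) (R : realType)
    (mu : {measure set T -> \bar R}) (D : set T) (f g : T -> \bar R) :
  (forall x, D x -> 0 <= f x) -> (forall x, D x -> f x <= g x) ->
  \int[mu]_(x in D) f x <= \int[mu]_(x in D) g x.
Proof.
move=> f0 fg.
have g0 x : D x -> 0 <= g x by move=> Dx; exact: le_trans (f0 x Dx) (fg x Dx).
rewrite !ge0_integralE//; apply: le_ereal_sup => _ [h hf <-]; exists h => //= x.
rewrite (le_trans (hf x))// /patch; case: ifPn => // /set_mem Dx.
exact: fg.
Qed.

End IntegralMono.

Section SingularMajorant.
Context {R : realType}.
Implicit Types (a c x y : R).
Local Notation leb := (@lebesgue_measure R).

Definition dyadic_itv c (k : nat) : set R :=
  [set` `[c - 2^-1 ^+ k, c + 2^-1 ^+ k]].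

(** A measurable majorant of [|x - c| ^ (- a)], built from dyadic intervals so
    that its integral is a geometric series.  For [a > 0] its value at [c] is [+oo]; with the
    power itself, which takes the value 0 at [c] by convention, the bounds on closed
    intervals would fail at the singularity. *)
Definition singular_majorant a c x : \bar R :=
  (1 + \sum_(0 <= k <oo) ((2 `^ a) ^+ k.+1 * \1_(dyadic_itv c k) x)%:E)%E.

Let term_ge0 a c x k :
  (0 <= ((2 `^ a) ^+ k.+1 * \1_(dyadic_itv c k) x)%:E)%E.
Proof. by rewrite lee_fin mulr_ge0// exprn_ge0// powR_ge0. Qed.

Lemma singular_majorant_ge0 a c x : (0 <= singular_majorant a c x)%E.
Proof. by rewrite adde_ge0// nneseries_ge0. Qed.

Let one_powR a : (1 : R) `^ a = 1.
Proof. by rewrite powR1. Qed.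

(** The hypothesis stands for [y <= |x - c| ^ (- a)], and makes sense at
    [x = c], where every [y] is allowed. *)
Lemma singular_majorant_ge a c x y : 0 < a ->
  `|x - c| `^ a * y <= 1 -> (y%:E <= singular_majorant a c x)%E.
Proof.
move=> a0 xy; rewrite /singular_majorant.
have [y1|y1] := leP y 1.
  by rewrite -[leLHS]adde0 leeD// ?lee_fin// nneseries_ge0.
have w1 : 1 < 2 `^ a.
  rewrite -[ltLHS](one_powR a) gt0_ltr_powR// ?nnegrE// ?ltr1n//.
have w0 : 0 < 2 `^ a by exact: lt_trans w1.
suff [k yk xk] : exists2 k, y <= (2 `^ a) ^+ k.+1 & `|x - c| <= 2^-1 ^+ k.
  rewrite -[leLHS]add0e leeD// ?lee_fin//.
  apply: le_trans (nneseries_lim_ge k.+1 _) => //.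
  rewrite big_nat_recr//= -[leLHS]add0e leeD//.
    by rewrite sume_ge0.
  rewrite lee_fin indicE mem_set ?mulr1// /dyadic_itv/= in_itv/=.
  by move: xk; rewrite ler_distl.
have [->|xc] := eqVneq x c.
  have : (2 `^ a)^-1 ^+ k @[k --> \oo] --> (0 : R).
    by apply: cvg_expr; rewrite gtr0_norm ?invr_gt0// invf_lt1.
  move=> /cvgrPdist_lt/(_ y^-1); rewrite invr_gt0 (lt_trans _ y1)// => /(_ isT)[k _ Hk].
  exists k; last by rewrite subrr normr0 exprn_ge0.
  have := Hk k.+1 (leqnSn k); rewrite sub0r normrN exprVn
    gtr0_norm ?invr_gt0 ?exprn_gt0//.
  by rewrite ltf_pV2 ?posrE ?exprn_gt0// ?(lt_trans _ y1)// => /ltW.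
have d0 : 0 < `|x - c| by rewrite normr_gt0 subr_eq0.
have exk : exists k, 2^-1 ^+ k.+1 < `|x - c|.
  have : (2^-1 : R) ^+ k @[k --> \oo] --> (0 : R).
    by apply: cvg_expr; rewrite gtr0_norm ?invr_gt0// invf_lt1// ltr1n.
  move=> /cvgrPdist_lt/(_ _ d0)[k _ Hk]; exists k.
  by have := Hk k.+1 (leqnSn k); rewrite sub0r normrN gtr0_norm// exprn_gt0// invr_gt0.
(* The least such [k] places [|x - c|] between two consecutive powers of 1/2. *)
case: (ex_minnP exk) => k kx kmin.
exists k.
  have h : (2^-1 ^+ k.+1) `^ a <= `|x - c| `^ a.
    by rewrite ge0_ler_powR// ?nnegrE ?exprn_ge0// ltW.
  have h2 : (2^-1 ^+ k.+1) `^ a = ((2 `^ a) ^+ k.+1)^-1.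
    have V : ((2 : R)^-1 `^ a) = (2 `^ a)^-1.
      by rewrite -powR_inv1// -powRrM mulN1r powRN.
    have -> : (2^-1 : R) ^+ k.+1 = 2^-1 `^ k.+1%:R by rewrite powR_mulrn.
    by rewrite powRAC V powR_mulrn ?invr_ge0 ?powR_ge0// exprVn.
  rewrite h2 in h; rewrite -[leRHS]mul1r -ler_pdivrMr ?exprn_gt0//.
  rewrite (le_trans _ xy)// mulrC ler_wpM2r// ltW//; exact: lt_trans y1.
case: k kx kmin => [|k] kx kmin.
  rewrite expr0 leNgt; apply/negP => x1.
  have : 1 <= `|x - c| `^ a.
    by rewrite -[leLHS](one_powR a) ge0_ler_powR ?nnegrE// ltW.
  move=> h; have : y <= `|x - c| `^ a * y.
    by rewrite ler_peMl// ltW// (lt_trans _ y1).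
  by move=> /le_trans /(_ xy); rewrite leNgt y1.
by rewrite leNgt; apply/negP => /kmin; rewrite ltnn.
Qed.

Let measurable_dyadic c k : measurable (dyadic_itv c k).
Proof. exact: measurable_itv. Qed.

Let measurable_term a c k (D : set R) :
  measurable_fun D (fun x => ((2 `^ a) ^+ k.+1 * \1_(dyadic_itv c k) x)%:E).
Proof.
by apply/measurable_EFinP; apply: measurable_funM.
Qed.

Lemma measurable_singular_majorant a c (D : set R) :
  measurable_fun D (singular_majorant a c).
Proof.
by apply: emeasurable_funD => //; apply: ge0_emeasurable_sum.
Qed.

(** The [k]-th term contributes at most [2 ^ (a * (k + 1))] times the length
    [2 * 2 ^ (- k)], a geometric sequence of ratio [2 ^ a / 2 < 1]. *)
Lemma integral_singular_majorant a c (D : set R) : 0 < a -> a < 1 ->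
  measurable D -> (leb D < +oo)%E ->
  (\int[leb]_(x in D) singular_majorant a c x < +oo)%E.
Proof.
move=> a0 a1 mD Doo.
have w0 : 0 < 2 `^ a by rewrite powR_gt0.
have w2 : 2 `^ a < 2.
  have : 1 < 2 `^ (1 - a).
    by rewrite -[ltLHS](one_powR (1 - a)) gt0_ltr_powR// ?nnegrE// ?subr_gt0// ltr1n.
  rewrite -(ltr_pM2l w0) mulr1 -powRD ?pnatr_eq0 ?implybT//.
  by rewrite addrCA subrr addr0 powRr1.
pose rho := 2 `^ a / 2.
have r0 : 0 <= rho by rewrite divr_ge0// ltW.
have r1 : rho < 1 by rewrite ltr_pdivrMr// mul1r.
rewrite ge0_integralD//; last 2 first.
- by move=> x _; apply: nneseries_ge0 => k _ _; exact: term_ge0.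
- apply: ge0_emeasurable_sum => [k x _ _|k _]; first exact: term_ge0.
  exact: measurable_term.
rewrite integral_cst// mul1e integral_nneseries//; last first.
  by move=> k; exact: measurable_term.
rewrite lte_add_pinfty//.
apply: (@le_lt_trans _ _ (2 * 2 `^ a * (1 - rho)^-1)%:E); last exact: ltry.
apply: lime_le.
  by apply: is_cvg_nneseries => k _ _; apply: integral_ge0 => x _.
apply: nearW => n.
have tb k : (\int[leb]_(x in D) ((2 `^ a) ^+ k.+1 * \1_(dyadic_itv c k) x)%:E <=
    (2 * 2 `^ a * rho ^+ k)%:E)%E.
  under eq_integral do rewrite EFinM.
  rewrite ge0_integralZl//; last first.
    apply/measurable_EFinP; apply: measurable_indic; exact: measurable_dyadic.
  rewrite integral_indic//; last exact: measurable_dyadic.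
  have len : (leb (dyadic_itv c k) <= (2 * 2^-1 ^+ k)%:E)%E.
    rewrite /dyadic_itv lebesgue_measure_itv/= lte_fin.
    case: ifP => _; last by rewrite lee_fin mulr_ge0// exprn_ge0.
    by rewrite -EFinD lee_fin le_eqVlt; apply/orP; left; apply/eqP; ring.
  have le1 : (leb (dyadic_itv c k `&` D) <= (2 * 2^-1 ^+ k)%:E)%E.
    apply: le_trans len; apply: le_measure; rewrite ?inE//.
      by apply: measurableI => //; exact: measurable_dyadic.
    exact: measurable_dyadic.
  apply: (@le_trans _ _ (((2 `^ a) ^+ k.+1)%:E * (2 * 2^-1 ^+ k)%:E)%E).
    by rewrite lee_wpmul2l// lee_fin exprn_ge0// ltW.
  rewrite -EFinM lee_fin /rho expr_div_n exprS exprVn le_eqVlt; apply/orP; left.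
  by apply/eqP; ring.
apply: (@le_trans _ _ (\sum_(0 <= k < n) (2 * 2 `^ a * rho ^+ k)%:E)%E).
  exact: lee_sum.
rewrite sumEFin lee_fin -mulr_sumr ler_wpM2l ?mulr_ge0 ?(ltW w0)//.
by have := geometric_tail 0 n r0 r1; rewrite expr0 div1r.
Qed.

End SingularMajorant.

(** * Growth of the circle means and bound on the norm *)

Section BqBound.
Context {R : realType}.
Local Notation C := (Cplx R).
Local Notation nc := (@Normc.normc R).
Local Notation leb := (@lebesgue_measure R).

Lemma measure_circle_lty : (leb [set` `[0%R, (2 * pi)%R]] < +oo)%E.
Proof.
rewrite lebesgue_measure_itv/=; case: ifP => _; last exact: ltry.
by rewrite -EFinD ltry.
Qed.

Lemma M1_ge0 (r : R) (g : C -> C) : (0 <= M1 r g)%E.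
Proof.
rewrite /M1 mule_ge0 ?lee_fin ?invr_ge0 ?mulr_ge0 ?pi_ge0//.
by apply: integral_ge0 => t _; rewrite lee_fin normc_ge0.
Qed.

Lemma M1_le (r e : R) (g : C -> C) : 0 <= r ->
  (forall z, nc z = r -> nc (g z) <= e) -> (M1 r g <= e%:E)%E.
Proof.
move=> r0 ge.
have e0 : 0 <= e.
  by apply: le_trans (ge (r%:C)%C _); rewrite ?normc_ge0 ?normc_real ?ger0_norm.
have pi0 := pi_gt0 R.
rewrite /M1; set I := (X in (_ * X)%E).
have : (I <= e%:E * (2 * pi)%:E)%E.
  apply: (@le_trans _ _ (\int[leb]_(t in `[0%R, (2 * pi)%R]) (cst e%:E t))%E).
    apply: ge0_integral_mono => t _; rewrite lee_fin ?normc_ge0//.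
    by apply: ge; rewrite normc_circle.
  rewrite integral_cst//= lebesgue_measure_itv/= lte_fin mulr_gt0//.
  by rewrite -EFinD subr0.
move=> /(lee_wpmul2l (_ : (0 <= ((2 * pi)^-1)%:E)%E)) => /(_ _)/le_trans; apply.
  by rewrite lee_fin invr_ge0 mulr_ge0 ?ltW.
by rewrite -!EFinM lee_fin mulrCA mulVf ?mulr1// gt_eqF// mulr_gt0.
Qed.

(** On the circle of radius [r], [|g|] is at most [2 * A / d], where
    [d = max (1 - r) (m / 8)] and [m] is the distance from [theta] to the ends of
    [[0, 2 * pi]].  Splitting [d = d ^ (1 - a) * d ^ a] bounds [1 / d] by
    [8 * (1 - r) ^ (a - 1) * m ^ (- a)], and the last factor is
    integrable because [a < 1]. *)
Lemma M1_growth (a : R) : 0 < a -> a < 1 ->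
  exists2 K : R, 0 <= K &
  forall (A r : R) (b : nat -> C) (g : C -> C),
    0 < A -> moment_like A b -> power_series_of g b -> 0 <= r -> r < 1 ->
    (M1 r g <= (K * A * (1 - r) `^ (a - 1))%:E)%E.
Proof.
move=> a0 a1; have pi0 := pi_gt0 R.
pose W x := (singular_majorant a 0 x + singular_majorant a (2 * pi) x)%E.
pose D : set R := [set` `[0%R, (2 * pi)%R]].
have mD : measurable D by exact: measurable_itv.
have W0 x : (0 <= W x)%E by rewrite adde_ge0// singular_majorant_ge0.
have mW : measurable_fun D W.
  by apply: emeasurable_funD; exact: measurable_singular_majorant.
have IWoo : (\int[leb]_(x in D) W x < +oo)%E.
  rewrite ge0_integralD//; [|by move=> x _; exact: singular_majorant_ge0
    |exact: measurable_singular_majorant|by move=> x _; exact: singular_majorant_ge0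
    |exact: measurable_singular_majorant].
  by apply: lte_add_pinfty; apply: integral_singular_majorant => //;
    exact: measure_circle_lty.
have IW0 : (0 <= \int[leb]_(x in D) W x)%E by exact: integral_ge0.
pose J := fine (\int[leb]_(x in D) W x)%E.
have JE : (\int[leb]_(x in D) W x)%E = J%:E by rewrite fineK// ge0_fin_numE.
exists ((2 * pi)^-1 * 16 * J).
  have J0 : 0 <= J by exact: fine_ge0.
  by rewrite !mulr_ge0// invr_ge0 mulr_ge0// ltW.
move=> A r b g A0 Ab gb r0 r1.
have r1' : 0 < 1 - r by rewrite subr_gt0.
pose k := 16 * A * (1 - r) `^ (a - 1).
have pw0 : 0 < (1 - r) `^ (a - 1) by rewrite powR_gt0.
have pwE : (1 - r) `^ (a - 1) * (1 - r) `^ (1 - a) = 1.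
  rewrite -powRD ?(gt_eqF r1') ?implybT//.
  by rewrite (_ : a - 1 + (1 - a) = 0) ?powRr0//; ring.
have k0 : 0 < k by rewrite !mulr_gt0.
have bound t : D t -> ((nc (g ((r%:C)%C * cis t)))%:E <= k%:E * W t)%E.
  rewrite /D/= in_itv/= => /andP[t0 t1].
  set y := nc _; have y0 : 0 <= y by exact: normc_ge0.
  pose m := Num.min t (2 * pi - t).
  have m0 : 0 <= m by rewrite le_min t0 subr_ge0.
  pose d := Num.max (1 - r) (m / 8).
  have d0 : 0 < d by rewrite lt_max r1'.
  have yd : y <= A * (2 / d).
    apply: (moment_like_kernel Ab gb) => //; first by rewrite normc_circle.
    by move=> s s0 s1; apply: circle_gap.
  have md : m `^ a <= 8 * d `^ a.
    have m8 : m <= 8 * d by rewrite mulrC -ler_pdivrMr// /d le_max lexx orbT.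
    apply: (@le_trans _ _ ((8 * d) `^ a)).
      by apply: ge0_ler_powR; rewrite ?nnegrE// ltW// mulr_gt0.
    rewrite powRM// ?(ltW d0)// ler_wpM2r ?powR_ge0//.
    by apply: ler1_powR; rewrite ?ler1n// ltW.
  have rd : (1 - r) `^ (1 - a) <= d `^ (1 - a).
    have rled : 1 - r <= d by rewrite /d le_max lexx.
    by apply: ge0_ler_powR; rewrite ?nnegrE// ?subr_ge0 ltW.
  have dE : d `^ a * d `^ (1 - a) = d.
    by rewrite -powRD ?(gt_eqF d0) ?implybT// addrCA subrr addr0 powRr1// ltW.
  have main : m `^ a * (y / k) <= 1.
    rewrite mulrA ler_pdivrMr// mul1r.
    have h1 : m `^ a * (1 - r) `^ (1 - a) <= 8 * d.
      rewrite -[in leRHS]dE mulrA ler_pM ?powR_ge0//.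
    have h2 : m `^ a * y * (1 - r) `^ (1 - a) <= 16 * A.
      rewrite mulrAC (le_trans (ler_pM _ _ h1 yd))// ?mulr_ge0 ?powR_ge0//.
      rewrite le_eqVlt; apply/orP; left; apply/eqP; field.
      by rewrite gt_eqF.
    rewrite -[leLHS]mulr1 -pwE mulrCA mulrC /k; apply: ler_wpM2r => //.
    exact: ltW.
  have yW : ((y / k)%:E <= W t)%E.
    have : m = t \/ m = 2 * pi - t by rewrite /m minEle; case: ifP; [left|right].
    case=> mE; rewrite mE in main.
      rewrite -[leLHS]adde0; apply: leeD; last exact: singular_majorant_ge0.
      by apply: singular_majorant_ge => //; rewrite subr0 ger0_norm.
    rewrite -[leLHS]add0e; apply: leeD; first exact: singular_majorant_ge0.
    apply: singular_majorant_ge => //; rewrite distrC ger0_norm//.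
    by rewrite subr_ge0.
  have -> : y%:E = (k%:E * (y / k)%:E)%E.
    by rewrite -EFinM mulrCA divff ?mulr1// gt_eqF.
  by rewrite lee_wpmul2l// lee_fin ltW.
rewrite /M1.
apply: (@le_trans _ _ (((2 * pi)^-1)%:E * (k%:E * J%:E))%E).
  apply: lee_wpmul2l; first by rewrite lee_fin invr_ge0 mulr_ge0// ltW.
  rewrite -JE -ge0_integralZl// ?lee_fin ?(ltW k0)//.
  by apply: ge0_integral_mono => // t _; rewrite lee_fin normc_ge0.
by rewrite -!EFinM lee_fin le_eqVlt; apply/orP; left; apply/eqP; rewrite /k; ring.
Qed.

Lemma Bq_norm_ge0 (q : R) (g : C -> C) : (0 <= Bq_norm q g)%E.
Proof.
apply: integral_ge0 => r _; rewrite mule_ge0 ?M1_ge0//.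
by rewrite lee_fin powR_ge0.
Qed.

(** Let [kap] be a positive number with [kap - 1 <= 1 / q - 2] and
    [kap <= 1], and take [tau = kap / 4].  The weight is at most
    [(1 - r) ^ (kap - 1)], the mean over the circle is at most
    [L * A * (1 - r) ^ (- tau)] for all [r] and at most [e] for [r <= rho].
    For [r > rho] one more factor [(1 - r) ^ tau <= (1 - rho) ^ tau] is split off;
    what remains is [(1 - r) ^ (kap / 2 - 1)] in both ranges, which is integrable. *)
Lemma Bq_norm_bound (q : R) : 0 < q -> q < 1 ->
  exists K L tau : R, [/\ 0 <= K, 0 <= L, 0 < tau &
  forall (A rho e : R) (b : nat -> C) (g : C -> C),
    0 < A -> moment_like A b -> power_series_of g b -> 0 <= rho -> rho < 1 ->
    (forall z, nc z <= rho -> nc (g z) <= e) ->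
    (Bq_norm q g <= (K * (e + L * A * (1 - rho) `^ tau))%:E)%E].
Proof.
move=> q0 q1.
pose kap := Num.min (q^-1 - 1) 1.
have kap0 : 0 < kap by rewrite lt_min subr_gt0 invf_gt1// q1 ltr01.
have kap1 : kap <= 1 by rewrite ge_min lexx orbT.
have kapq : kap - 1 <= q^-1 - 2.
  have : kap <= q^-1 - 1 by rewrite ge_min lexx.
  lra.
pose tau := kap / 4; have tau0 : 0 < tau by rewrite divr_gt0.
have [L L0 HL] : exists2 L : R, 0 <= L &
  forall (A r : R) (b : nat -> C) (g : C -> C),
    0 < A -> moment_like A b -> power_series_of g b -> 0 <= r -> r < 1 ->
    (M1 r g <= (L * A * (1 - r) `^ (1 - tau - 1))%:E)%E.
  by apply: M1_growth; rewrite /tau; lra.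
pose a := 1 - kap / 2.
have a0 : 0 < a by rewrite /a; lra.
have a1 : a < 1 by rewrite /a; lra.
pose D : set R := [set` `[0%R, 1%R[].
have mD : measurable D by exact: measurable_itv.
pose S := singular_majorant a 1.
have S0 x : (0 <= S x)%E by exact: singular_majorant_ge0.
have IS0 : (0 <= \int[leb]_(x in D) S x)%E by exact: integral_ge0.
have ISoo : (\int[leb]_(x in D) S x < +oo)%E.
  apply: integral_singular_majorant => //.
  rewrite /D lebesgue_measure_itv/=; case: ifP => _; last exact: ltry.
  by rewrite -EFinD ltry.
pose K := fine (\int[leb]_(x in D) S x)%E.
have KE : (\int[leb]_(x in D) S x)%E = K%:E by rewrite fineK// ge0_fin_numE.
exists K, L, tau; split=> //; first exact: fine_ge0.
move=> A rho e b g A0 Ab gb rho0 rho1 ge.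
have e0 : 0 <= e.
  by apply: le_trans (ge 0 _); rewrite ?normc_ge0 ?normc_zero.
have LA0 : 0 <= L * A by rewrite mulr_ge0// ltW.
pose E := e + L * A * (1 - rho) `^ tau.
have E0 : 0 <= E by rewrite addr_ge0// mulr_ge0// powR_ge0.
rewrite mulrC EFinM -KE.
rewrite -ge0_integralZl// ?lee_fin//; last exact: measurable_singular_majorant.
rewrite /Bq_norm; apply: ge0_integral_mono => r.
  by move=> _; rewrite mule_ge0 ?M1_ge0// lee_fin powR_ge0.
rewrite /= in_itv/= => /andP[r0 r1].
have r1' : 0 < 1 - r by rewrite subr_gt0.
have rn0 : 1 - r != 0 by rewrite gt_eqF.
have r1'' : 0 < 1 - r <= 1 by rewrite r1' /= lerBlDr lerDl.
have wle : (1 - r) `^ (q^-1 - 2) <= (1 - r) `^ (kap - 1).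
  exact: ger_powR.
have SE : (((1 - r) `^ (- a))%:E <= S r)%E.
  apply: singular_majorant_ge => //.
  rewrite distrC gtr0_norm// -powRD ?rn0 ?implybT// subrr powRr0//.
apply: (@le_trans _ _ (E%:E * ((1 - r) `^ (- a))%:E)%E); last first.
  by rewrite lee_wpmul2l// lee_fin.
have M1E : (M1 r g <= (E * (1 - r) `^ (- (tau *+ 2)))%:E)%E.
  have [rr|rr] := leP r rho.
    apply: (@le_trans _ _ e%:E).
      by apply: M1_le => // z zr; apply: ge; rewrite zr.
    rewrite lee_fin -[leLHS]mulr1; apply: ler_pM => //.
      by rewrite lerDl mulr_ge0// powR_ge0.
    rewrite -[leLHS](powRr0 (1 - r)); apply: ger_powR => //.
    by rewrite oppr_le0 mulrn_wge0// ltW.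
  apply: le_trans (HL A r b g A0 Ab gb r0 r1) _.
  rewrite lee_fin.
  have -> : (1 - r) `^ (1 - tau - 1) = (1 - r) `^ tau * (1 - r) `^ (- (tau *+ 2)).
    rewrite -powRD ?rn0 ?implybT//; congr (_ `^ _); rewrite mulr2n; ring.
  rewrite mulrA ler_wpM2r ?powR_ge0//.
  rewrite -[leLHS]add0r lerD// ler_wpM2l//.
  have rhor : 1 - r <= 1 - rho by rewrite lerD2l lerN2 ltW.
  by apply: ge0_ler_powR; rewrite ?nnegrE// ?subr_ge0 ltW.
apply: (@le_trans _ _ (((1 - r) `^ (kap - 1))%:E * (E * (1 - r) `^ (- (tau *+ 2)))%:E)%E).
  by apply: lee_pmul => //; rewrite ?M1_ge0 ?lee_fin ?powR_ge0.
have wE : (1 - r) `^ (kap - 1) * (1 - r) `^ (- (tau *+ 2)) = (1 - r) `^ (- a).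
  rewrite -powRD ?rn0 ?implybT//; congr (_ `^ _); rewrite /a /tau mulr2n; by field.
by rewrite -!EFinM lee_fin mulrCA wE.
Qed.

End BqBound.

(** * Termwise convergent subsequences *)

Section Diagonal.
Context {R : realType}.
Local Notation C := (Cplx R).
Local Notation nc := (@Normc.normc R).

(** The real and imaginary parts of the coefficients form a sequence in a
    product of compact segments, which has a cluster point by Tychonoff's
    theorem.  Neighbourhoods of the cluster point control finitely many
    coefficients at a time, and the sequence visits them at arbitrarily late
    indices, so a subsequence can be selected step by step. *)
Lemma bounded_coefs_subsequence (b : nat -> nat -> C) (B : R) :
  (forall j n, nc (b j n) <= B) ->
  exists (phi : nat -> nat) (beta : nat -> C),
    {homo phi : i j / (i < j)%N} /\
    forall n, b (phi j) n @[j --> \oo] --> beta n.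
Proof.
move=> bB.
pose T (_ : (nat * bool)%type) : topologicalType := R.
pose X (j : nat) : prod_topology T :=
  fun i => if i.2 then complex.Re (b j i.1) else complex.Im (b j i.1).
have cpt := @tychonoff _ T (fun _ => [set` `[- B, B]%R])
  (fun _ => @segment_compact _ _ _).
have XB : (X @ \oo) [set f | forall i, [set` `[- B, B]%R] (f i)].
  exists 0%N => // j _ -[n [|]]; rewrite /X/= in_itv/= -ler_norml.
    exact: le_trans (normc_Re _) (bB j n).
  exact: le_trans (normc_Im _) (bB j n).
have [p [_ clp]] := cpt (X @ \oo) _ XB.
pose beta n : C := (p (n, true) +i* p (n, false))%C.
have step (N m : nat) : exists2 j, (m < j)%N &
    forall n, (n < N)%N -> nc (b j n - beta n) < N.+1%:R^-1.
  pose e : R := N.+1%:R^-1 / 2.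
  have e0 : 0 < e by rewrite divr_gt0// invr_gt0.
  have near_i (i : nat * bool) :
      nbhs p (fun f : prod_topology T => `|(p i : R) - f i| < e).
    have ball_i : nbhs (p i : R) [set y : R | `|(p i : R) - y| < e].
      have := nbhsx_ballx (p i : R) e e0; exact.
    exact: (@proj_continuous _ T i p _ ball_i).
  have Fp : Filter (nbhs p) by exact: nbhs_filter.
  have near_N (M : nat) : nbhs p (fun f : prod_topology T => forall n, (n < M)%N ->
      `|(p (n, true) : R) - f (n, true)| < e /\ `|(p (n, false) : R) - f (n, false)| < e).
    elim: M => [|M IH]; first by apply: (@filterE _ _ Fp) => f n; rewrite ltn0.
    have near_M := @filterI _ _ Fp _ _ (near_i (M, true)) (near_i (M, false)).
    apply: (@filterS _ _ Fp) (@filterI _ _ Fp _ _ IH near_M).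
    move=> f [H [h1 h2]] n; rewrite ltnS leq_eqVlt => /orP[/eqP ->//|]; exact: H.
  have Xm : (X @ \oo) (X @` [set j | (m < j)%N]).
    by apply: filterS (nbhs_infty_gt m) => j mj; exists j.
  have [f [[j mj <-] Hf]] := clp _ _ Xm (near_N N).
  exists j => // n nN; have [h1 h2] := Hf n nN.
  rewrite normc_sub; apply: le_lt_trans (normc_ReIm _) _.
  rewrite (splitr (N.+1%:R^-1)); apply: ltrD; [move: h1|move: h2];
    by rewrite /X /beta/=; case: (b j n).
pose J N m := projT1 (cid2 (step N m)).
have J1 N m : (m < J N m)%N by rewrite /J; case: cid2.
have J2 N m n : (n < N)%N -> nc (b (J N m) n - beta n) < N.+1%:R^-1.
  by rewrite /J; case: cid2 => j /= _; apply.
pose phi := fix phi k := if k is k'.+1 then J k'.+1 (phi k') else J 0%N 0%N.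
exists phi, beta; split.
  by apply: homo_ltn => [y x z|k]; [exact: ltn_trans|exact: J1].
move=> n; apply/cvg_normcP => e e0.
have [k1 _ Hk1] : \forall k \near \oo, (k.+1%:R^-1 : R) < e.
  by have := near_infty_natSinv_lt (PosNum e0).
exists (maxn k1 n.+1) => // -[|k] /=; rewrite geq_max => /andP[kk nk] //.
exact: lt_trans (J2 k.+1 (phi k) n nk) (Hk1 _ kk).
Qed.

End Diagonal.

(** * Compactness *)

Section Compactness.
Context {R : realType}.
Local Notation C := (Cplx R).
Local Notation nc := (@Normc.normc R).

Lemma Hinf_norm_le (f : C -> C) (M : R) :
  (Hinf_norm f <= M%:E)%E -> forall z, unit_disc z -> nc (f z) <= M.
Proof.
move=> fM z Dz; rewrite -lee_fin (le_trans _ fM)//.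
by apply: ereal_sup_ubound; exists z.
Qed.

Lemma Hinf_bounded (f : C -> C) :
  Hinf f -> exists M : R, forall z, unit_disc z -> nc (f z) <= M.
Proof.
move=> [_ foo]; exists (fine (Hinf_norm f)); apply: Hinf_norm_le.
rewrite fineK// ge0_fin_numE//.
apply: (@le_trans _ _ (nc (f 0))%:E); first by rewrite lee_fin normc_ge0.
by apply: ereal_sup_ubound; exists 0 => //; rewrite unit_discE normc_zero.
Qed.

Lemma moment_like_ge0 (A : R) (b : nat -> C) : moment_like A b -> 0 <= A.
Proof.
by move=> /(moment_like_coef 0%N); apply: le_trans; exact: normc_ge0.
Qed.

Lemma moment_like_le (A A' : R) (b : nat -> C) :
  moment_like A b -> A <= A' -> moment_like A' b.
Proof.
move=> Ab AA' N c K HK; apply: le_trans (Ab N c K HK) _.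
by rewrite ler_wpM2r//; apply: le_trans (HK 0 _ _); rewrite ?normc_ge0.
Qed.

Lemma power_series_ofB (g h : C -> C) (b beta : nat -> C) :
  power_series_of g b -> power_series_of h beta ->
  power_series_of (fun z => g z - h z) (fun n => b n - beta n).
Proof.
move=> gb hbeta z z1.
have -> : series (fun n => (b n - beta n) * z ^+ n) =
    (fun N => series (fun n => b n * z ^+ n) N - series (fun n => beta n * z ^+ n) N).
  by apply/funext => N; rewrite /series/= -sumrB; apply: eq_bigr => n _; rewrite mulrBl.
exact: (cvgB (gb z z1) (hbeta z z1)).
Qed.

Lemma moment_like_analytic (A : R) (b : nat -> C) (g : C -> C) :
  moment_like A b -> power_series_of g b -> analytic_disc g.
Proof.
by move=> Ab; apply: (@power_series_analytic _ g b A) => n; exact: moment_like_coef.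
Qed.

Lemma moment_like_Bq (q A : R) (b : nat -> C) (g : C -> C) : 0 < q -> q < 1 ->
  moment_like A b -> power_series_of g b -> Bq q g.
Proof.
move=> q0 q1 Ab gb; split; first exact: moment_like_analytic Ab gb.
have [K [L [tau [K0 L0 tau0 HB]]]] := Bq_norm_bound q0 q1.
have A0 := moment_like_ge0 Ab.
apply: le_lt_trans (HB (A + 1) 0 A b g _ _ gb _ _ _) _ => //.
- by rewrite ltr_wpDl.
- by apply: moment_like_le Ab _; rewrite lerDl.
(* With [rho = 0] only the value at the origin is left to bound. *)
- move=> z z0; have z0' : nc z = 0 by apply/le_anti; rewrite z0 normc_ge0.
  have z1 : nc z < 1 by rewrite z0'.
  rewrite (power_seriesE gb z1).
  have bA n : nc (b n) <= A by exact: moment_like_coef.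
  by have := normc_pser bA z1; rewrite z0' subr0 divr1.
- exact: ltry.
Qed.

(** For [|z| <= rho] the terms of index at least [N] sum to at most
    [B * rho ^ N / (1 - rho)], and the [N] first ones to at most the sum of their
    coefficients. *)
Lemma coef_cvg_locally_uniform (d : nat -> nat -> C) (G : nat -> C -> C)
    (B rho e : R) :
  (forall j n, nc (d j n) <= B) -> (forall n, d j n @[j --> \oo] --> (0 : C)) ->
  (forall j, power_series_of (G j) (d j)) -> 0 <= rho -> rho < 1 -> 0 < e ->
  \forall j \near \oo, forall z, nc z <= rho -> nc (G j z) <= e.
Proof.
move=> dB d0 Gd rho0 rho1 e0.
have B0 : 0 <= B := le_trans (normc_ge0 _) (dB 0%N 0%N).
have e2 : 0 < e / 2 by rewrite divr_gt0.
have tail0 : B * (rho ^+ N / (1 - rho)) @[N --> \oo] --> (0 : R).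
  rewrite -[X in _ --> X](mulr0 B); apply: cvgMr.
  rewrite -[X in _ --> X](mul0r (1 - rho)^-1); apply: cvgMl.
  by apply: cvg_expr; rewrite ger0_norm.
have /cvgrPdist_lt/(_ _ e2)[N _ HN] := tail0.
have {}HN : B * (rho ^+ N / (1 - rho)) <= e / 2.
  by have := HN N (leqnn N); rewrite sub0r normrN => /(le_lt_trans (ler_norm _))/ltW.
have head0 : \sum_(0 <= n < N) nc (d j n) @[j --> \oo] --> (0 : R).
  rewrite [X in _ --> X](_ : _ = \sum_(0 <= n < N) (0 : R)); last by rewrite big1.
  apply: cvg_big => [|n _]; first exact: add_continuous.
  by rewrite -[X in _ --> X](@normc_zero R); exact: cvg_normc.
have /cvgrPdist_lt/(_ _ e2) := head0; apply: filterS => j.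
rewrite sub0r normrN => /(le_lt_trans (ler_norm _))/ltW Hj z zr.
have z1 : nc z < 1 by exact: le_lt_trans rho1.
apply: (cvg_normc_le (Gd j z z1)); exists N => // L /= NL.
rewrite /series/= (big_cat_nat (n := N))//=.
apply: le_trans (normc_triangle _ _) _; rewrite [e]splitr; apply: lerD.
  apply: le_trans Hj; apply: le_trans (normc_sum _ _ _) _.
  apply: ler_sum => n _; rewrite normc_mul normc_exp ler_piMr ?normc_ge0//.
  by rewrite exprn_ile1 ?normc_ge0// ltW.
apply: le_trans HN; apply: le_trans (bounded_series_tail N L (dB j) z1) _.
rewrite ler_wpM2l// ler_pM ?exprn_ge0 ?normc_ge0 ?invr_ge0 ?subr_ge0 ?(ltW z1)//.
  by rewrite lerXn2r ?nnegrE ?normc_ge0.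
by rewrite lef_pV2 ?posrE ?subr_gt0// lerD2l lerN2.
Qed.

(** Fix [rho] close enough to 1 for the boundary part of the bound on the norm
    to be small, uniformly in [j]; then let [j] grow. *)
Lemma coef_cvg_Bq (q A : R) (b : nat -> nat -> C) (beta : nat -> C)
    (g : nat -> C -> C) (h : C -> C) : 0 < q -> q < 1 ->
  (forall j, moment_like A (b j)) -> (forall j, power_series_of (g j) (b j)) ->
  (forall n, b j n @[j --> \oo] --> beta n) -> power_series_of h beta ->
  Bq_norm q (fun z => g j z - h z) @[j --> \oo] --> 0%E.
Proof.
move=> q0 q1 Ab gb bbeta hbeta.
have Abeta : moment_like A beta by exact: moment_like_lim bbeta.
have A0 := moment_like_ge0 Abeta.
pose A' := A + A + 1.
have A'0 : 0 < A' by rewrite ltr_wpDl// addr_ge0.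
pose d j n := b j n - beta n.
have Ad j : moment_like A' (d j).
  by apply: moment_like_le (moment_likeB (Ab j) Abeta) _; rewrite lerDl.
pose G j z := g j z - h z.
have Gd j : power_series_of (G j) (d j) by exact: (power_series_ofB (gb j) hbeta).
have d0 n : d j n @[j --> \oo] --> (0 : C).
  by rewrite -(subrr (beta n)); apply: cvgB; [exact: bbeta|exact: cvg_cst].
have [K [L [tau [K0 L0 tau0 HB]]]] := Bq_norm_bound q0 q1.
have small e : 0 < e -> \forall j \near \oo, (Bq_norm q (G j) <= e%:E)%E.
  move=> e0.
  have KLA : 0 <= K * (L * A') by rewrite !mulr_ge0// ltW.
  pose eta := e / 2 / (K * (L * A') + 1).
  have eta0 : 0 < eta by rewrite !divr_gt0// ltr_wpDl.
  (* [delta = 1 - rho] is chosen so that [delta `^ tau <= eta]. *)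
  pose delta := Num.min 1 (eta `^ tau^-1).
  have delta0 : 0 < delta by rewrite lt_min ltr01 powR_gt0.
  have delta1 : delta <= 1 by rewrite ge_min lexx.
  have deltaE : delta `^ tau <= eta.
    rewrite (@le_trans _ _ ((eta `^ tau^-1) `^ tau))//.
      apply: ge0_ler_powR; rewrite ?nnegrE ?powR_ge0//; [exact: ltW|exact: ltW|].
      by rewrite ge_min lexx orbT.
    by rewrite -powRrM mulVf ?powRr1 ?(gt_eqF tau0)// ltW.
  pose e' := e / 2 / (K + 1).
  have e'0 : 0 < e' by rewrite !divr_gt0// ltr_wpDl.
  have rho0 : 0 <= 1 - delta by rewrite subr_ge0.
  have rho1 : 1 - delta < 1 by rewrite ltrBlDr ltrDl.
  have := coef_cvg_locally_uniform (fun j n => moment_like_coef n (Ad j))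
    d0 Gd rho0 rho1 e'0.
  apply: filterS => j Hj.
  apply: le_trans (HB _ _ _ _ _ A'0 (Ad j) (Gd j) rho0 rho1 Hj) _.
  rewrite lee_fin subKr mulrDr [leRHS]splitr; apply: lerD.
    rewrite /e' mulrCA ler_piMr ?divr_ge0 ?(ltW e0)// ler_pdivrMr ?ltr_wpDl//.
    by rewrite mul1r lerDl.
  rewrite mulrA (le_trans (ler_wpM2l KLA deltaE))// /eta mulrCA.
  by rewrite ler_piMr ?divr_ge0 ?(ltW e0)// ler_pdivrMr ?ltr_wpDl// mul1r lerDl.
apply/fine_cvgP; split.
  apply: filterS (small 1 ltr01) => j Hj.
  by rewrite ge0_fin_numE ?Bq_norm_ge0// (le_lt_trans Hj)// ltry.
apply/cvgrPdist_le => e e0; apply: filterS (small e e0) => j Hj.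
rewrite sub0r normrN ger0_norm; last by rewrite fine_ge0// Bq_norm_ge0.
rewrite -lee_fin fineK// ge0_fin_numE ?Bq_norm_ge0//.
by rewrite (le_lt_trans Hj)// ltry.
Qed.

End Compactness.

Theorem theorem1p5 (R : realType) (q : R) (hq0 : 0 < q) (hq1 : q < 1)
    (mu : {finite_measure set (measurableTypeR R) -> \bar R})
    (hmu : mu (~` `[0, 1[) = 0%E) :
  (forall (f : Cplx R -> Cplx R) (a b : nat -> Cplx R),
     Hinf f -> power_series_of f a -> hilbert_coefs mu a b ->
     exists g : Cplx R -> Cplx R, hilbert_op mu f g) /\
  compact_Hinf_Bq q (hilbert_op mu).
Proof.
split=> [f a b /Hinf_bounded[M fM] fa hb|].
  have Ab := hilbert_coefs_moment_like fM fa hb.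
  have gb : power_series_of (pser b) b.
    by apply: power_series_pser => n; exact: moment_like_coef n Ab.
  exists (pser b); split; first exact: moment_like_analytic Ab gb.
  by exists a, b; split.
split=> [f g /Hinf_bounded[M fM] [_ [a [b [fa hb gb]]]]|f g M _ fM Tfg].
  exact: moment_like_Bq (hilbert_coefs_moment_like fM fa hb) gb.
pose A := 2 * M * mass mu.
have /choice[b Hb] j : exists b, moment_like A b /\ power_series_of (g j) b.
  have [_ [a [b [fa hb gb]]]] := Tfg j; exists b; split => //.
  exact: hilbert_coefs_moment_like (Hinf_norm_le (fM j)) fa hb.
have [phi [beta [phiS bbeta]]] :=
  bounded_coefs_subsequence (fun j n => moment_like_coef n (Hb j).1).
have Abeta : moment_like A beta.
  by apply: moment_like_lim bbeta => j; exact: (Hb (phi j)).1.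
have hbeta : power_series_of (pser beta) beta.
  by apply: power_series_pser => n; exact: moment_like_coef n Abeta.
exists phi, (pser beta); split; first exact: phiS.
  exact: (moment_like_Bq hq0 hq1 Abeta hbeta).
apply: (coef_cvg_Bq hq0 hq1 _ _ bbeta hbeta) => j.
  exact: (Hb (phi j)).1.
exact: (Hb (phi j)).2.
Qed.
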